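(* Let $R$ be a commutative ring with identity $1\neq 0$ and let $G$ be an abelian group which is not a torsion group. Then the group ring $RG$ is complemented if and only if $R$ is reduced, the minimal prime spectrum $\operatorname{Min}(R)$ is compact, and $o(G)\subseteq \operatorname{reg}(R)$.
   Context: All rings are commutative with identity $1\neq 0$. Abelian groups are written multiplicatively, and $RG$ denotes the group ring of $G$ over $R$. For a ring $S$, $\operatorname{reg}(S)$ denotes the set of regular elements (non-zero-divisors) of $S$. An element $x\in S$ is called complemented (in $S$) if there is a $y\in S$ such that $xy=0$ and $x+y\in\operatorname{reg}(S)$; the ring $S$ is called complemented if every element of $S$ is complemented. $\operatorname{Min}(R)$ denotes the space of minimal prime ideals of $R$ equipped with the hull-kernel (Zariski) topology; compact means that every open cover has a finite subcover (no separation axiom is required). $o(G)$ denotes the set of orders of elements of the torsion subgroup $t(G)$ of $G$ (the set of elements of finite order). The containment $o(G)\subseteq\operatorname{reg}(R)$ means that for every $n\in o(G)$ the element $n\cdot 1_R$ is regular in $R$. A group is torsion if all of its elements have finite order. *)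

(* Defs.v *)
From HB Require Import structures.
From mathcomp Require Import all_boot all_order all_algebra finmap.
From mathcomp Require Import ring_quotient.
From mathcomp Require Import boolp classical_sets topology.
From mathcomp Require Import monalg.

Set Implicit Arguments.
Unset Strict Implicit.
Unset Printing Implicit Defensive.

Import GRing.Theory.

Local Open Scope classical_set_scope.
Local Open Scope ring_scope.

Definition reg (S : comNzRingType) : set S :=
  [set x | forall y, x * y = 0 -> y = 0].

Lemma reg_lreg (S : comNzRingType) (x : S) : reg x <-> GRing.lreg x.
Proof.
split=> [|rx y /eqP]; first exact: mulrI0_lreg.
by rewrite (mulrI_eq0 _ rx) => /eqP.
Qed.

Definition complemented_elt (S : comNzRingType) (x : S) : Prop :=
  exists2 y : S, x * y = 0 & reg (x + y).

Definition complemented (S : comNzRingType) : Prop :=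
  forall x : S, complemented_elt x.

Definition reduced (S : comNzRingType) : Prop :=
  forall (x : S) (n : nat), x ^+ n = 0 -> x = 0.

Definition prime_ideal (R : comNzRingType) (P : {pred R}) : Prop :=
  idealr_closed P /\ prime_idealr_closed P.

Definition minimal_prime (R : comNzRingType) (P : {pred R}) : Prop :=
  prime_ideal P /\
  forall Q : {pred R}, prime_ideal Q -> {subset Q <= P} -> {subset P <= Q}.

Record MinSpec (R : comNzRingType) := MkMinSpec {
  min_ideal : {pred R};
  min_idealP : minimal_prime min_ideal }.

HB.instance Definition _ (R : comNzRingType) := gen_eqMixin (MinSpec R).
HB.instance Definition _ (R : comNzRingType) := gen_choiceMixin (MinSpec R).

Section HullKernel.
Variable R : comNzRingType.

Definition hull (A : set R) : set (MinSpec R) :=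
  [set P | forall x, A x -> x \in min_ideal P].

Definition hk_open : set_system (MinSpec R) :=
  [set U | exists A : set R, U = ~` hull A].

Let hk_openT : hk_open setT.
Proof.
exists [set 1]; apply/esym; rewrite -subTset => P _ hP.
by have [[[_ /negP P1 _] _] _] := min_idealP P; apply/P1/hP.
Qed.

Let hk_openI : setI_closed hk_open.
Proof.
move=> _ _ [A ->] [B ->].
exists [set z | exists2 u, A u & exists2 v, B v & z = u * v].
rewrite -setCU; congr (~` _); apply/seteqP; split=> P /=.
  have [[[P0 _ Pl] _] _] := min_idealP P.
  have Pm a u : u \in min_ideal P -> a * u \in min_ideal P.
    by move=> uP; rewrite -[a * u]addr0; exact: Pl.
  case=> [hA|hB] _ [u Au [v Bv ->]]; last exact/Pm/hB.
  by rewrite mulrC; exact/Pm/hA.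
have [[_ Pp] _] := min_idealP P.
move=> hAB; case: (pselect (hull A P)) => [|nA]; [by left | right=> v Bv].
have [u Au uP] : exists2 u, A u & u \notin min_ideal P.
  apply: contrapT => nu; apply: nA => u Au.
  by apply: contrapT => /negP uP; apply: nu; exists u.
have /Pp : u * v \in min_ideal P by apply: hAB; exists u => //; exists v.
by rewrite (negbTE uP).
Qed.

Let hk_open_bigU (I : Type) (f : I -> set (MinSpec R)) :
  (forall i, hk_open (f i)) -> hk_open (\bigcup_i f i).
Proof.
move=> /choice[A fA]; exists (\bigcup_i A i); apply/seteqP; split=> P /=.
  by move=> [i _]; rewrite fA => nh hU; apply: nh => x Ax; apply: hU; exists i.
move=> nh; apply: contrapT => nf; apply: nh => x [i _ Ax].
apply: contrapT => xP; apply: nf; exists i => //; rewrite fA => h.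
exact/xP/h.
Qed.

HB.instance Definition _ := @isOpenTopological.Build (MinSpec R)
  hk_open hk_openT hk_openI hk_open_bigU.

Lemma open_hk (U : set (MinSpec R)) : open U = hk_open U. Proof. by []. Qed.

End HullKernel.

(* The group law is written additively: g *+ n is the n-th power of g. *)
Section Orders.
Variable G : zmodType.

Definition torsion_part : set G :=
  [set g | exists2 n : nat, (0 < n)%N & g *+ n = 0].

Definition is_order (g : G) (n : nat) : Prop :=
  [/\ (0 < n)%N, g *+ n = 0
    & forall m : nat, (0 < m)%N -> g *+ m = 0 -> (n <= m)%N].

Definition torsion_orders : set nat :=
  [set n | exists2 g, torsion_part g & is_order g n].

Definition torsion_group : Prop := forall g : G, torsion_part g.

End Orders.

(* {malg R[G]} is the free R-module on G. The ring structure that monalg puts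
   on it requires a monoid without nontrivial units, hence this alias, on which
   the product is the convolution for the (additive) group law of G. *)
Definition group_ring (R : comNzRingType) (G : zmodType) : Type := {malg R[G]}.

HB.instance Definition _ R G := GRing.Lmodule.on (group_ring R G).

Section GroupRing.
Variables (R : comNzRingType) (G : zmodType).
Implicit Types (x y z : group_ring R G) (g h : G).

Definition gr_one : group_ring R G := << (0 : G) >>.

Definition gr_mul x y : group_ring R G :=
  \sum_(g <- msupp x) \sum_(h <- msupp y) << x@_g * y@_h *g (g + h)%R >>.

Lemma gr_mulw (d1 d2 : {fset G}) x y :
  (msupp x `<=` d1)%fset -> (msupp y `<=` d2)%fset ->
  gr_mul x y =
  \sum_(g <- d1) \sum_(h <- d2) << x@_g * y@_h *g (g + h)%R >>.
Proof.
move=> le_d1 le_d2; rewrite /gr_mul (big_fset_incl _ le_d1) /=.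
  apply/eq_bigr=> g _; apply/big_fset_incl => // h _ /mcoeff_outdom ->.
  by rewrite mulr0 monalgU0.
move=> g _ /mcoeff_outdom xg.
by rewrite big1 => // h _; rewrite xg mul0r monalgU0.
Qed.

Let gr_mulC : commutative gr_mul.
Proof.
move=> x y; rewrite /gr_mul exchange_big /=; apply: eq_bigr => g _.
by apply: eq_bigr => h _; rewrite mulrC addrC.
Qed.

Lemma gr_mulUU (a b : R) g h :
  gr_mul << a *g g >> << b *g h >> = << a * b *g (g + h)%R >>.
Proof. by rewrite (gr_mulw msuppU_le msuppU_le) !big_seq_fset1 !mcoeffUU. Qed.

Let gr_mulDl : left_distributive gr_mul +%R.
Proof.
move=> x y z.
rewrite [in RHS](gr_mulw (fsubsetUl _ (msupp y)) (fsubset_refl _)).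
rewrite [in RHS](gr_mulw (fsubsetUr (msupp x) _) (fsubset_refl _)).
rewrite (gr_mulw (msuppD_le _ _) (fsubset_refl _)).
rewrite -big_split /=; apply/eq_bigr=> g _.
rewrite -big_split /=; apply/eq_bigr=> h _.
by rewrite mcoeffD mulrDl monalgUD.
Qed.

Let gr_mulDr : right_distributive gr_mul +%R.
Proof. by move=> x y z; rewrite !(gr_mulC x) gr_mulDl. Qed.

Let gr_mul0 : left_zero 0 gr_mul.
Proof. by move=> x; rewrite /gr_mul msupp0 big_seq_fset0. Qed.

Lemma gr_ind (P : group_ring R G -> Prop) :
  P 0 -> (forall x y, P x -> P y -> P (x + y)) ->
  (forall a g, P << a *g g >>) -> forall x, P x.
Proof.
move=> P0 PD PU x; rewrite (monalgE x : x = _).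
by elim/big_ind: _ => // *; exact: PD.
Qed.

Let gr_mulr0 x : gr_mul x 0 = 0. Proof. by rewrite gr_mulC gr_mul0. Qed.

Let gr_mulA : associative gr_mul.
Proof.
move=> x y z; elim/gr_ind: x => [|x1 x2 IH1 IH2|a g]; first by rewrite !gr_mul0.
  by rewrite !gr_mulDl IH1 IH2.
elim/gr_ind: y => [|y1 y2 IH1 IH2|b h]; first by rewrite gr_mulr0 !gr_mul0 gr_mulr0.
  by rewrite gr_mulDl !gr_mulDr gr_mulDl IH1 IH2.
elim/gr_ind: z => [|z1 z2 IH1 IH2|c k]; first by rewrite !gr_mulr0.
  by rewrite !gr_mulDr IH1 IH2.
by rewrite !gr_mulUU mulrA addrA.
Qed.

Let gr_mul1 : left_id gr_one gr_mul.
Proof.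
move=> x; elim/gr_ind: x => [|x y IHx IHy|a g]; first by rewrite gr_mulr0.
  by rewrite gr_mulDr IHx IHy.
by rewrite gr_mulUU mul1r add0r.
Qed.

Let gr_one_neq0 : gr_one != 0.
Proof. by apply/eqP/malgP=> /(_ 0) /eqP; rewrite mcoeffUU mcoeff0 oner_eq0. Qed.

HB.instance Definition _ := GRing.Zmodule_isComNzRing.Build (group_ring R G)
  gr_mulA gr_mulC gr_mul1 gr_mulDl gr_one_neq0.

Lemma gr_mulE x y : x * y = gr_mul x y. Proof. by []. Qed.

End GroupRing.

(* Main.v *)
From HB Require Import structures.
Require Import Defs.
From mathcomp Require Import all_boot all_order all_algebra.
From mathcomp Require Import finmap.
From mathcomp Require Import boolp classical_sets topology filter.
From mathcomp Require Import monalg.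

Set Implicit Arguments.
Unset Strict Implicit.
Unset Printing Implicit Defensive.

Import GRing.Theory.

Local Open Scope classical_set_scope.
Local Open Scope ring_scope.

(** The theorem is reduced to statements about annihilators. Over a reduced
    ring R, compactness of the minimal spectrum means that each r has a finite
    family F of elements killing r such that only 0 kills both r and F
    (compact_ann_complement, ann_complement_compact). A reduced ring is
    complemented when F can be taken to be one element; over RG, an element of infinite
    order lets one pack a finite family into a single element, by placing its
    members in different degrees.

    If RG is complemented, it is reduced. Its constants show that R is reduced;
    the coefficients of a complement of a constant r form a family F as above;
    and if r n = 0 where n is the order of g, the sum of the powers of g times
    r squares to 0, whence r = 0.

    Conversely, let T be the torsion subgroup of G. The elements of RG supported
    in T form a reduced ring: T is exhausted by adjoining elements one prime
    index at a time (reduced_on_prime_step). This ring is integral over R, and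
    annihilator complements go up integral extensions into reduced rings: they
    are computed from the coefficients of a monic equation
    (ann_complement_integral). The quotient G / T is torsion-free, hence can be
    totally ordered (total_cone), so arguments on top components show that RG
    is reduced (group_ring_reduced) and that whatever kills an element of RG
    kills its components in the grading by G / T (component_ann). Given x in
    RG, a family F complementing the components of x, its members being
    moved by multiples of an element of infinite order to degrees where they
    meet neither x nor each other, adds up to a complement of x. *)

(** * Zorn's lemma above a given set *)

(** The chains of the library statement may be empty, whereas multiplicative
    sets and cones have to contain a given set: maximality is therefore asked
    of S `|` X rather than of X. *)
Lemma Zorn_above (T : Type) (P : set (set T)) (S : set T) :
  P S ->
  (forall F : set (set T), F `<=` P -> total_on F subset -> F !=set0 ->
     P (\bigcup_(X in F) X)) ->
  exists A, [/\ P A, S `<=` A & forall B, A `<=` B -> P B -> B `<=` A].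
Proof.
move=> PS Pchain.
have [F sF totF|A [PA Amax]] := @Zorn_bigcup T [set X | P (S `|` X)].
  have [[X0 FX0]|F0] := pselect (F !=set0); last first.
    suff -> : \bigcup_(X in F) X = set0 by rewrite /mkset setU0.
    by rewrite -subset0 => x [X FX _]; apply: F0; exists X.
  rewrite /mkset.
  have -> : S `|` \bigcup_(X in F) X = \bigcup_(Y in [set S `|` X | X in F]) Y.
    apply/seteqP; split=> x.
      case=> [Sx|[X FX Xx]]; first by exists (S `|` X0); [exists X0|left].
      by exists (S `|` X); [exists X|right].
    by case=> _ [X FX <-] [Sx|Xx]; [left|right; exists X].
  apply: Pchain => [_ [X FX <-]|_ _ [X FX <-] [Y FY <-]|].
  - exact: sF.
  - by case: (totF X Y FX FY) => h; [left|right]; apply: setUS.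
  - by exists (S `|` X0); exists X0.
exists (S `|` A); split; [exact: PA | exact: subsetUl |].
move=> B sB PB x Bx; apply: contrapT => nAx.
apply: (Amax B); last first.
  rewrite /mkset (_ : S `|` B = B) //; apply/seteqP; split=> y; last by right.
  by case=> // Sy; apply: sB; left.
split=> [y Ay|/(_ x Bx) Ax]; first by apply: sB; right.
by apply: nAx; right.
Qed.

(** * Minimal primes of a reduced ring *)

Lemma reduced_of_sqr (A : comNzRingType) :
  (forall x : A, x * x = 0 -> x = 0) -> reduced A.
Proof.
move=> red2 x n; elim/ltn_ind: n => -[|[|n]] IH; rewrite ?expr1//.
  by rewrite expr0 => /eqP; rewrite oner_eq0.
move=> xn; apply: (IH n.+1) => //; apply: red2.
by rewrite -exprD addSnnS exprD xn mulr0.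
Qed.

Section MinimalPrimes.
Variable R : comNzRingType.
Implicit Types (P : MinSpec R) (x y : R).

Lemma min_ideal0 P : 0 \in min_ideal P.
Proof. by have [[[]]] := min_idealP P. Qed.

Lemma min_ideal1 P : 1 \notin min_ideal P.
Proof. by have [[[]]] := min_idealP P. Qed.

Lemma min_idealMl P x y : y \in min_ideal P -> x * y \in min_ideal P.
Proof.
have [[[P0 _ Pl] _] _] := min_idealP P.
by move=> yP; rewrite -[x * y]addr0; apply: Pl.
Qed.

Lemma min_idealM P x y :
  (x * y \in min_ideal P) = (x \in min_ideal P) || (y \in min_ideal P).
Proof.
have [[_ Pp] _] := min_idealP P.
apply/idP/idP => [/Pp //|/orP[|]]; last exact: min_idealMl.
by rewrite mulrC; apply: min_idealMl.
Qed.

Hypothesis redR : reduced R.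

(** The complement of a maximal multiplicative set A avoiding 0 is a minimal
    prime. Maximality gives every a outside A a killer s in A: the set of all
    s * a ^+ n contains 0, and reducedness brings the exponent down to 1.
    Killers multiply, which makes the complement an ideal, and they show that
    no prime ideal is strictly smaller. *)
Lemma minimal_prime_avoiding (S : set R) :
  S 1 -> (forall u v, S u -> S v -> S (u * v)) -> ~ S 0 ->
  exists P, forall s, S s -> s \notin min_ideal P.
Proof.
move=> S1 SM S0.
pose mult (X : set R) :=
  [/\ X 1, forall u v, X u -> X v -> X (u * v) & ~ X 0].
have [//|F sF totF [X0 FX0]|A [[A1 AM A0] sSA Amax]] := @Zorn_above R mult S.
  split=> [|u v [X FX Xu] [Y FY Yv]|[X FX]].
  - by exists X0 => //; have [] := sF _ FX0.
  - have [XY|YX] := totF _ _ FX FY.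
      by exists Y => //; have [_ + _] := sF _ FY; apply => //; apply: XY.
    by exists X => //; have [_ + _] := sF _ FX; apply => //; apply: YX.
  - by have [] := sF _ FX.
have Akill a : ~ A a -> exists2 s, A s & s * a = 0.
  move=> nAa; apply: contrapT => nkill; apply: nAa.
  pose B := [set z | exists2 s, A s & exists n, z = s * a ^+ n].
  apply: (Amax B); last by exists 1 => //; exists 1%N; rewrite mul1r expr1.
    by move=> s As; exists s => //; exists 0%N; rewrite expr0 mulr1.
  split.
  - by exists 1 => //; exists 0%N; rewrite expr0 mulr1.
  - move=> _ _ [s As [n ->]] [t At [m ->]]; exists (s * t); first exact: AM.
    by exists (n + m)%N; rewrite exprD mulrACA.
  - move=> [s As [n sa0]]; apply: nkill; exists s => //.
    case: n sa0 => [|n] sa0; first by case: A0; rewrite sa0 expr0 mulr1.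
    by apply: (@redR _ n.+1); rewrite exprMn exprSr -mulrA -sa0 mulr0.
pose Q : {pred R} := [pred x | `[< ~ A x >]].
have QE x : x \in Q <-> ~ A x by split=> [/asboolP|/asboolP].
have nQE x : x \notin Q <-> A x.
  split=> [xQ|Ax]; last by apply/negP => /QE; apply.
  by apply: contrapT => /QE xQ'; rewrite xQ' in xQ.
have primeQ : prime_ideal Q.
  split; first split; first exact/QE.
  - exact/nQE.
  - move=> a u v /QE/Akill[s As su] /QE/Akill[t At tv]; apply/QE => Auv.
    apply: A0; suff <- : s * t * (a * u + v) = 0 by apply/(AM _ _ _ Auv)/AM.
    rewrite mulrDr (mulrC s t) [t * s * _]mulrAC -mulrA -mulrA (mulrC u).
    by rewrite su !mulr0 add0r (mulrC t s) -mulrA tv mulr0.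
  - move=> u v /QE nAuv; apply: contrapT => /negP; rewrite negb_or.
    by case/andP=> /nQE Au /nQE Av; apply/nAuv/AM.
have minQ : minimal_prime Q.
  split=> // Q' [[Q'0 _ _] Q'p] sQ' x /QE/Akill[s /nQE sQ sx].
  move: Q'0; rewrite -sx => /Q'p /orP[/sQ'|//].
  by rewrite (negbTE sQ).
by exists (MkMinSpec minQ) => s /sSA /nQE.
Qed.

(** Otherwise the products s * x ^+ n with s outside P avoid 0, and a minimal
    prime avoiding them would lie inside P without containing x. *)
Lemma minimal_prime_kill P x :
  x \in min_ideal P -> exists2 s, s \notin min_ideal P & s * x = 0.
Proof.
move=> xP; apply: contrapT => nkill.
pose S := [set z | exists2 s, s \notin min_ideal P & exists n, z = s * x ^+ n].
have Ssub s : s \notin min_ideal P -> S s.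
  by exists s => //; exists 0%N; rewrite expr0 mulr1.
have [||[s sP [n sx0]]|P' P'S] := @minimal_prime_avoiding S.
- exact/Ssub/min_ideal1.
- move=> _ _ [s sP [n ->]] [t tP [m ->]]; exists (s * t).
    by rewrite min_idealM negb_or sP.
  by exists (n + m)%N; rewrite exprD mulrACA.
- apply: nkill; exists s => //; apply: (@redR _ n.+1).
  by rewrite exprMn exprSr (exprSr x) -mulrA (mulrA s) -sx0 mul0r mulr0.
have /negP[] : x \notin min_ideal P'.
  apply: P'S; exists 1; first exact: min_ideal1.
  by exists 1%N; rewrite mul1r.
have [_ Pmin] := min_idealP P; apply: Pmin => //.
  by case: (min_idealP P').
by move=> y; apply: contraLR => /Ssub/P'S.
Qed.

Lemma minimal_prime_killseq P (cs : seq R) : {subset cs <= min_ideal P} ->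
  exists2 s, s \notin min_ideal P & forall c, c \in cs -> s * c = 0.
Proof.
elim: cs => [|c cs IH] csP; first by exists 1 => //; exact: min_ideal1.
have [|s sP scs] := IH; first by move=> d dcs; apply: csP; rewrite inE dcs orbT.
have [|t tP tc] := @minimal_prime_kill P c.
  by apply: csP; rewrite mem_head.
exists (s * t); first by rewrite min_idealM negb_or sP.
move=> d; rewrite inE => /orP[/eqP ->|/scs sd].
  by rewrite -mulrA tc mulr0.
by rewrite mulrAC sd mul0r.
Qed.

End MinimalPrimes.

(** * Compactness of the minimal spectrum as a condition on annihilators *)

Definition faithful (A : comNzRingType) (s : seq A) :=
  forall z : A, (forall c, c \in s -> z * c = 0) -> z = 0.

(** In a reduced ring and with cs a single element, this is complementedness
    with the annihilating element relaxed to a finite family F. *)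
Definition ann_complement (A : comNzRingType) (cs F : seq A) :=
  (forall c f, c \in cs -> f \in F -> c * f = 0) /\ faithful (cs ++ F).

Section Compactness.
Variable R : comNzRingType.
Hypothesis redR : reduced R.

(** In terms of the basic open sets D(a), consisting of the minimal primes
    that avoid a: a minimal prime containing all of cs avoids an element that
    kills cs, so the D(c) for c in cs and the D(f) for f killing cs cover the
    space. A finite subcover provides F: what kills cs and F lies in every
    minimal prime, hence vanishes. *)
Lemma compact_ann_complement (cs : seq R) :
  cover_compact [set: MinSpec R] -> exists F, ann_complement cs F.
Proof.
move=> cpt.
pose D := [set f | f \in cs \/ forall c, c \in cs -> c * f = 0].
pose U (a : R) : set (MinSpec R) := ~` hull [set a].
have UE a P : U a P <-> a \notin min_ideal P.
  by split=> [h|/negP aP /(_ a erefl)//]; apply/negP => aP; apply: h => _ ->.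
have [a _|P _|D' D'D cov] := cpt R D U.
- by rewrite open_hk; exists [set a].
- have [csP|] := pselect {subset cs <= min_ideal P}.
    have [s sP scs] := minimal_prime_killseq redR csP.
    exists s; last exact/UE.
    by right=> c /scs; rewrite mulrC.
  move=> /existsNP[c /not_implyP[ccs /negP cP]].
  by exists c; [left | exact/UE].
exists [seq f <- D' | all (fun c => c * f == 0) cs]; split.
  by move=> c f ccs; rewrite mem_filter => /andP[/allP/(_ c ccs)/eqP].
move=> z zkill; apply: contrapT => z0.
have [|||P zP] := @minimal_prime_avoiding _ redR [set z ^+ n | n in setT].
- by exists 0%N.
- by move=> _ _ [n _ <-] [m _ <-]; exists (n + m)%N; rewrite ?exprD.
- by move=> [n _ /redR].
have /negP : z \notin min_ideal P by apply: zP; exists 1%N; rewrite ?expr1.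
apply; have [i iD' /UE iP] := cov P I.
have zi : z * i = 0.
  apply: zkill; rewrite mem_cat mem_filter.
  have /set_mem[->//|ci] := D'D i iD'.
  by apply/orP; right; apply/andP; split=> //; apply/allP => c /ci ->.
by have := min_ideal0 P; rewrite -zi min_idealM (negbTE iP) orbF.
Qed.

(** Every ultrafilter G on the minimal spectrum converges. Its limit is the
    set Q of the elements contained in G-many minimal primes, which is always
    prime. The annihilator complements make it minimal: if x is in Q and F
    complements x, a minimal prime cannot contain x and all of F, so some f in
    F is outside Q, and x * f = 0. An ultrafilter containing the complements
    of all finite unions of members of a cover contradicts this. *)
Lemma ann_complement_compact :
  (forall r : R, exists F, ann_complement [:: r] F) ->
  cover_compact [set: MinSpec R].
Proof.
move=> annR I D U Uopen cov; apply: contrapT => nfin.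
pose Fi := [set A : set (MinSpec R) | exists2 D' : {fset I},
  {subset D' <= D} & ~` cover [set` D'] U `<=` A].
have FiF : Filter Fi.
  split.
  - by exists fset0 => // i; rewrite inE.
  - move=> A B [D1 sD1 sA] [D2 sD2 sB]; exists (D1 `|` D2)%fset.
      by move=> i; rewrite inE => /orP[/sD1|/sD2].
    move=> P nP; split; [apply: sA|apply: sB] => -[i iD' iP]; apply: nP;
      by exists i => //=; rewrite inE iD' ?orbT.
  - by move=> A B sAB [D' sD' sA]; exists D' => //; apply: subset_trans sAB.
have FiP : ProperFilter Fi.
  split=> // -[D' sD' cD']; apply: nfin; exists D' => // P _.
  by apply: contrapT => /cD'.
have [G [GU sFG]] := @ultraFilterLemma _ Fi FiP.
pose V (x : R) : set (MinSpec R) := [set P | x \in min_ideal P].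
have GV x : ~ G (V x) <-> G (~` V x).
  split=> [|GnV GV]; first by have [] := in_ultra_setVsetC (V x) GU.
  by apply: (@filter_not_empty _ G _); rewrite -(setICr (V x)); apply: filterI.
pose Q : {pred R} := [pred x | `[< G (V x) >]].
have QE x : x \in Q <-> G (V x) by split=> /asboolP.
have nQE x : x \notin Q <-> G (~` V x).
  rewrite -GV; split=> [/negP nxQ /QE//|nGx]; by apply/negP => /QE.
have primeQ : prime_ideal Q.
  split; first split.
  - by apply/QE; apply: filterS filterT => P _; apply: min_ideal0.
  - by apply/nQE; apply: filterS filterT => P _; apply/negP/min_ideal1.
  - move=> a u v /QE Gu /QE Gv; apply/QE; apply: filterS (filterI Gu Gv) => P.
    case=> uP vP; have [[[_ _ Pl] _] _] := min_idealP P; exact: Pl.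
  - move=> u v /QE Guv; apply: contrapT => /negP; rewrite negb_or.
    case/andP=> /nQE Gu /nQE Gv; apply: (@filter_not_empty _ G _).
    apply: filterS (filterI Guv (filterI Gu Gv)) => P [].
    by rewrite /V /= min_idealM => /orP[uP []|vP [_]].
have Gsub (s : seq R) : {subset s <= Q} ->
    G [set P | {subset s <= min_ideal P}].
  elim: s => [|c s IH] sQ; first by apply: filterS filterT => P _.
  have /QE Gc := sQ c (mem_head _ _).
  have Gs := IH (fun d ds => sQ d (mem_behead (ds : d \in behead (c :: s)))).
  apply: filterS (filterI Gc Gs) => P [cP sP] d.
  by rewrite inE => /orP[/eqP->|/sP].
have minQ : minimal_prime Q.
  split=> // Q' [[Q'0 _ _] Q'p] sQ' x /QE Gx.
  have [F [xF faithF]] := annR x.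
  have [f fF fQ] : exists2 f, f \in F & f \notin Q.
    apply: contrapT => nf; have FQ : {subset F <= Q}.
      by move=> f fF; apply: contrapT => /negP fQ; apply: nf; exists f.
    apply: (@filter_not_empty _ G _).
    apply: filterS (Gsub (x :: F) _) => [P xFP|c]; last first.
      by rewrite inE => /orP[/eqP->|/FQ//]; apply/QE.
    have [s sP skill] := minimal_prime_killseq redR xFP.
    by case/negP: sP; rewrite (faithF s skill) min_ideal0.
  have : x * f \in Q' by rewrite xF ?mem_head.
  by case/Q'p/orP => // /sQ'; rewrite (negbTE fQ).
have [i Di Ui] := cov (MkMinSpec minQ) Logic.I.
have := Uopen i Di; rewrite open_hk => -[A UA].
have [a Aa /nQE Ga] : exists2 a, A a & a \notin Q.
  apply: contrapT => nA; move: Ui; rewrite UA; apply => a Aa.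
  by apply: contrapT => /negP aQ; apply: nA; exists a.
have GnU : G (~` U i).
  apply: sFG; exists [fset i]%fset.
    by move=> j; rewrite inE => /eqP ->; apply/mem_set.
  by move=> P nP iP; apply: nP; exists i => //=; rewrite inE.
apply: (@filter_not_empty _ G _); apply: filterS (filterI Ga GnU) => P [aP].
by rewrite UA setCK => /(_ a Aa).
Qed.

End Compactness.

(** * Supports in a group ring *)

Definition mono (R : comNzRingType) (G : zmodType) (g : G) (a : R) :
  group_ring R G := << a *g g >>.

Definition coef (R : comNzRingType) (G : zmodType) (g : G)
  (x : group_ring R G) : R := x@_g.

Section GroupRingTheory.
Variables (R : comNzRingType) (G : zmodType).
Local Notation RG := (group_ring R G).
Implicit Types (a b : R) (g h : G) (x y z : RG) (A B : set G).

Fact mono_is_additive g : zmod_morphism (@mono R G g).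
Proof. exact: monalgUB. Qed.
HB.instance Definition _ g :=
  GRing.isZmodMorphism.Build R RG (@mono R G g) (mono_is_additive g).

Fact coef_is_additive g : zmod_morphism (@coef R G g).
Proof. exact: mcoeffB. Qed.
HB.instance Definition _ g :=
  GRing.isZmodMorphism.Build RG R (@coef R G g) (coef_is_additive g).

Lemma coef_mono g a h : coef g (mono h a) = if h == g then a else 0.
Proof. by rewrite /coef mcoeffU mulrb. Qed.

Lemma coef_inj x y : (forall g, coef g x = coef g y) -> x = y.
Proof. by move/malgP. Qed.

Lemma monoM a b g h : mono g a * mono h b = mono (g + h) (a * b).
Proof. exact: gr_mulUU. Qed.

Lemma mono10 : mono 0 1 = 1 :> RG. Proof. by []. Qed.

Lemma gr_sum x : x = \sum_(g <- msupp x) mono g (coef g x).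
Proof. exact: monalgE. Qed.

Lemma coef_msupp x g : (g \in msupp x) = (coef g x != 0).
Proof. by rewrite mcoeff_neq0. Qed.

Lemma coefM_mono g x a h : coef g (x * mono h a) = coef (g - h) x * a.
Proof.
elim/gr_ind: x => [|x y IHx IHy|b k].
- by rewrite mul0r !raddf0 mul0r.
- by rewrite mulrDl !raddfD /= IHx IHy mulrDl.
rewrite -/(mono k b) monoM !coef_mono [k == _]eq_sym subr_eq [g == _]eq_sym.
by case: eqP; rewrite ?mul0r.
Qed.

Lemma mono_mul x g : x * mono g 1 * mono (- g) 1 = x.
Proof. by rewrite -mulrA monoM subrr mulr1 mono10 mulr1. Qed.

Definition gr_const a : RG := mono 0 a.

Fact gr_const_is_additive : zmod_morphism gr_const.
Proof. exact: mono_is_additive. Qed.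
Fact gr_const_is_multiplicative : monoid_morphism gr_const.
Proof. by split=> // a b; rewrite /gr_const monoM addr0. Qed.
HB.instance Definition _ :=
  GRing.isZmodMorphism.Build R RG gr_const gr_const_is_additive.
HB.instance Definition _ :=
  GRing.isMonoidMorphism.Build R RG gr_const gr_const_is_multiplicative.

Lemma coefM_const g x a : coef g (x * gr_const a) = coef g x * a.
Proof. by rewrite coefM_mono subr0. Qed.

Definition supp_in A x := forall g, coef g x != 0 -> A g.

Lemma supp_in0 A : supp_in A 0.
Proof. by move=> g; rewrite raddf0 eqxx. Qed.

Lemma supp_inD A x y : supp_in A x -> supp_in A y -> supp_in A (x + y).
Proof.
move=> Ax Ay g; rewrite raddfD /=; have [x0|/Ax//] := eqVneq (coef g x) 0.
by rewrite x0 add0r => /Ay.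
Qed.

Lemma supp_in_mono A a g : A g -> supp_in A (mono g a).
Proof.
by move=> Ag h; rewrite coef_mono; case: (g =P h) => [<-//|_]; rewrite eqxx.
Qed.

Lemma supp_inS A B x : A `<=` B -> supp_in A x -> supp_in B x.
Proof. by move=> sAB Ax g /Ax/sAB. Qed.

Lemma supp_ind A (P : RG -> Prop) :
  P 0 -> (forall x y, P x -> P y -> P (x + y)) ->
  (forall a g, A g -> P (mono g a)) -> forall x, supp_in A x -> P x.
Proof.
move=> P0 PD PU x Ax; rewrite (gr_sum x) big_seq.
elim/big_ind: _ => // g; rewrite coef_msupp => /Ax; exact: PU.
Qed.

Lemma supp_inM A B C x y : (forall g h, A g -> B h -> C (g + h)) ->
  supp_in A x -> supp_in B y -> supp_in C (x * y).
Proof.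
move=> ABC Ax By; elim/(@supp_ind A): x / Ax => [|x x' IH IH'|a g Ag].
- by rewrite mul0r; exact: supp_in0.
- by rewrite mulrDl; exact: supp_inD.
elim/(@supp_ind B): y / By => [|y y' IH IH'|b h Bh].
- by rewrite mulr0; exact: supp_in0.
- by rewrite mulrDr; exact: supp_inD.
by rewrite monoM; apply: supp_in_mono; apply: ABC.
Qed.

Definition restrict A x : RG :=
  [malg g in msupp x => if `[< A g >] then x@_g else 0].

Lemma coef_restrict A x g :
  coef g (restrict A x) = if `[< A g >] then coef g x else 0.
Proof.
rewrite /coef /restrict mcoeffE; case: ifP => // /negbT/mcoeff_outdom ->.
by case: ifP.
Qed.

Fact restrict_is_additive A : zmod_morphism (restrict A).
Proof.
move=> x y; apply/coef_inj => g; rewrite raddfB /= !coef_restrict.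
by case: ifP; rewrite ?raddfB ?subr0.
Qed.
HB.instance Definition _ A :=
  GRing.isZmodMorphism.Build RG RG (restrict A) (restrict_is_additive A).

Lemma restrict_mono A a g :
  restrict A (mono g a) = if `[< A g >] then mono g a else 0.
Proof.
apply/coef_inj => h; rewrite coef_restrict coef_mono.
have [->|ngh] := eqVneq g h.
  by case: ifP; rewrite ?coef_mono ?eqxx ?raddf0.
by rewrite !if_same; case: ifP; rewrite ?coef_mono ?raddf0 // (negbTE ngh).
Qed.

Lemma supp_in_restrict A x : supp_in A (restrict A x).
Proof. by move=> g; rewrite coef_restrict; case: asboolP; rewrite ?eqxx. Qed.

End GroupRingTheory.

Arguments coef {R G}.
Arguments supp_in {R G}.
Arguments restrict {R G}.
Arguments gr_const {R G}.

(** The linear extension of f to the group rings. It is a ring morphism on the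
    elements supported in a set on which f is additive. Locked, since
    comparing two images by unfolding is costly. *)
HB.lock Definition push (R : comNzRingType) (G H : zmodType) (f : G -> H)
    (x : group_ring R G) : group_ring R H :=
  mmap (mono 0) (fun g => mono (f g) 1) x.
Canonical push_unlockable := Unlockable push.unlock.

Section Push.
Variables (R : comNzRingType) (G H : zmodType) (f : G -> H).
Local Notation push := (@push R G H f).

Fact push_is_additive : zmod_morphism push.
Proof. by move=> x y; rewrite unlock; exact: mmap_is_additive. Qed.
HB.instance Definition _ :=
  GRing.isZmodMorphism.Build (group_ring R G) (group_ring R H) push
    push_is_additive.

Lemma push_mono a g : push (mono g a) = mono (f g) a.
Proof. by rewrite unlock mmapU monoM mulr1 add0r. Qed.

Lemma pushM (L : set G) x y :
  (forall g h, L g -> L h -> f (g + h) = f g + f h) ->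
  supp_in L x -> supp_in L y -> push (x * y) = push x * push y.
Proof.
move=> fD Lx Ly; elim/(@supp_ind R G L): x / Lx => [|x x' IH IH'|a g Lg].
- by rewrite mul0r raddf0 mul0r.
- by rewrite mulrDl !raddfD /= IH IH' mulrDl.
elim/(@supp_ind R G L): y / Ly => [|y y' IH IH'|b h Lh].
- by rewrite mulr0 raddf0 mulr0.
- by rewrite mulrDr !raddfD /= IH IH' mulrDr.
by rewrite monoM !push_mono monoM fD.
Qed.

End Push.

(** * Reducedness when the supports consist of torsion elements *)

Section Nilpotents.
Variable A : comNzRingType.
Implicit Types x y : A.

Definition nilp x := exists n, x ^+ n = 0.

Lemma nilpMl x y : nilp y -> nilp (x * y).
Proof. by case=> n yn; exists n; rewrite exprMn yn mulr0. Qed.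

Lemma nilpD x y : nilp x -> nilp y -> nilp (x + y).
Proof.
move=> [n xn] [m ym]; exists (n + m)%N; rewrite exprDn big1// => i _.
have [le_mi|lt_im] := leqP m i.
  by rewrite -(subnK le_mi) exprD ym mulr0 mulr0 mul0rn.
rewrite -addnBA 1?ltnW// exprD xn mul0r mul0r mul0rn//.
Qed.

Lemma nilp_sum (I : Type) (r : seq I) (F : I -> A) :
  (forall i, nilp (F i)) -> nilp (\sum_(i <- r) F i).
Proof.
by move=> nF; elim/big_ind: _ => //; [exists 1%N; rewrite expr1|exact: nilpD].
Qed.

End Nilpotents.

Definition subgroup (G : zmodType) (K : set G) :=
  K 0 /\ forall u v, K u -> K v -> K (u - v).

Section Subgroups.
Variables (G : zmodType) (K : set G).
Hypothesis subK : subgroup K.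

Lemma subgroupB u v : K u -> K v -> K (u - v). Proof. exact: subK.2. Qed.

Lemma subgroupN u : K u -> K (- u).
Proof. by rewrite -sub0r; apply: subgroupB; exact: subK.1. Qed.

Lemma subgroupD u v : K u -> K v -> K (u + v).
Proof. by move=> Ku Kv; rewrite -[v]opprK; apply/subgroupB/subgroupN. Qed.

Lemma subgroupMn u n : K u -> K (u *+ n).
Proof.
move=> Ku; elim: n => [|n IH]; first by rewrite mulr0n; exact: subK.1.
by rewrite mulrSr; apply: subgroupD.
Qed.

(** The subgroup generated by K and g, when some positive multiple of g lies
   in K: nonnegative multiples of g are then enough. *)
Definition adjoin (g : G) : set G := [set u | exists j, K (u - g *+ j)].

Lemma adjoin_sub g : K `<=` adjoin g.
Proof. by move=> u Ku; exists 0%N; rewrite subr0. Qed.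

Lemma adjoin_gen g : adjoin g g.
Proof. by exists 1%N; rewrite subrr; exact: subK.1. Qed.

Lemma adjoin_subgroup g n : (0 < n)%N -> K (g *+ n) -> subgroup (adjoin g).
Proof.
move=> n0 Kgn; split; first exact/adjoin_sub/subK.1.
move=> u v [i Ki] [j Kj]; exists (i + j * n.-1)%N.
rewrite (_ : _ - _ = (u - g *+ i) - (v - g *+ j) - g *+ n *+ j).
  by apply: subgroupB; [exact: subgroupB | exact: subgroupMn].
have -> : g *+ n *+ j = g *+ j + g *+ (j * n.-1).
  by rewrite -mulrnDr -mulrnA mulnC -{1}(prednK n0) mulnS.
rewrite mulrnDr !opprD !opprK !addrA addrK.
by congr (_ - _); rewrite addrAC.
Qed.

End Subgroups.

Section ReducedOn.
Variables (R : comNzRingType) (G : zmodType).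
Implicit Types (K : set G) (x : group_ring R G).

Definition reduced_on K := forall x, supp_in K x -> x * x = 0 -> x = 0.

Lemma supp_in_exp K x n : subgroup K -> supp_in K x -> supp_in K (x ^+ n).
Proof.
move=> sK Kx; elim: n => [|n IH].
  by rewrite expr0 -mono10; apply: supp_in_mono; exact: sK.1.
by rewrite exprS; apply: supp_inM Kx IH => u v; apply: subgroupD.
Qed.

Lemma reduced_on_nilp K x :
  subgroup K -> reduced_on K -> supp_in K x -> nilp x -> x = 0.
Proof.
move=> sK redK Kx [n]; elim/ltn_ind: n => -[|[|n]] IH; rewrite ?expr1//.
  by rewrite expr0 => /eqP; rewrite oner_eq0.
move=> xn; apply: (IH n.+1) => //; apply: redK; first exact: supp_in_exp.
by rewrite -exprD addSnnS exprD xn mulr0.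
Qed.

End ReducedOn.

Arguments reduced_on R {G} K.

Lemma opprE (U V : zmodType) (a : U) (c : V) : - (a, c) = (- a, - c).
Proof. by []. Qed.

Lemma pairD (U V : zmodType) (a b : U) (c d : V) :
  (a, c) + (b, d) = (a + b, c + d).
Proof. by []. Qed.

Definition natreg (R : comNzRingType) (n : nat) :=
  forall r : R, r *+ n = 0 -> r = 0.

(** One adjoins to K an element g with p *: g in K for a prime p; L / K is
    then cyclic of order p. For k in F_p, sending u in L to (k * cls u, u) is
    a morphism from L to F_p * G, so it maps a square-zero x to the square-zero
    element twist k x. With N the sum of the elements of F_p and iota the
    inclusion at 0, summing the twists of a monomial at u gives N times the
    monomial if u is outside K, and p times it if u is in K. Hence
    (p - N) * iota (restrict K x) is nilpotent, which forces restrict K x = 0.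
    This stands in for averaging over the characters of L / K, without roots
    of unity in R. The field F plays the role of F_p. *)
Section PrimeStep.
Variables (R : comNzRingType) (G : zmodType) (K : set G) (p : nat) (g : G).
Variable F : finFieldType.
Hypotheses (pr_p : prime p) (charF : p \in [pchar F]) (cardF : #|F| = p).
Hypotheses (subK : subgroup K) (Kpg : K (g *+ p)) (nKg : ~ K g).
Hypothesis regp : natreg R p.

Local Notation L := (adjoin K g).

(** By Bezout, as p is prime and g is not in K. *)
Lemma K_mulrn d : K (g *+ d) <-> d%:R = 0 :> F.
Proof.
suff E : K (g *+ d) <-> (p %| d)%N.
  by rewrite E (dvdn_pcharf charF); split=> [/eqP|->].
split=> [Kd|/dvdnP[q ->]]; last by rewrite mulnC mulrnA; apply: subgroupMn.
apply: contrapT => /negP; rewrite -prime_coprime// coprime_sym => /eqP cop.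
have d0 : (0 < d)%N.
  rewrite lt0n; apply/eqP => d0; move: cop pr_p.
  by rewrite d0 gcd0n => ->.
case: (egcdnP p d0) => km kn; rewrite cop => /(congr1 (fun n => g *+ n)).
rewrite mulrnDr mulr1n (mulnC km) (mulnC kn) !mulrnA => E _; apply: nKg.
rewrite -[g](addKr (g *+ p *+ kn)) -E addrC.
by apply: (subgroupB subK); apply: (subgroupMn subK).
Qed.

(** The class of u in L / K, identified with F by sending that of g to 1; the
   value 0 outside L is arbitrary. *)
Let cls (u : G) : F :=
  xget 0 [set c | exists2 j, K (u - g *+ j) & c = j%:R].

Lemma clsP u j : K (u - g *+ j) -> cls u = j%:R.
Proof.
move=> Kj; have : exists c : F, exists2 j, K (u - g *+ j) & c = j%:R.
  by exists j%:R, j.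
case=> c cP; rewrite /cls; case: xgetP => [_ _ [i Ki ->]|/(_ c)//].
wlog le_ij : i j Ki Kj / (i <= j)%N => [th|].
  have [le_ij|/ltnW le_ji] := leqP i j; first exact: th.
  by apply/esym; exact: th.
rewrite -(subnK le_ij) natrD (_ : (j - i)%:R = 0) ?add0r//; apply/K_mulrn.
rewrite mulrnBr// (_ : _ - _ = (u - g *+ i) - (u - g *+ j)).
  exact: subgroupB.
by rewrite opprB [RHS]addrC addrA subrK.
Qed.

Lemma clsD u v : L u -> L v -> cls (u + v) = cls u + cls v.
Proof.
move=> [i Ki] [j Kj]; rewrite (clsP Ki) (clsP Kj) -natrD; apply: clsP.
by rewrite mulrnDr opprD addrACA; apply: subgroupD.
Qed.

Lemma cls_eq0 u : L u -> cls u = 0 <-> K u.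
Proof.
move=> [j Kj]; rewrite (clsP Kj) -K_mulrn; split=> Kgj.
  by rewrite -[u](subrK (g *+ j)); apply: subgroupD.
by rewrite -[g *+ j](subKr u); apply: subgroupB.
Qed.

Local Notation RH := (group_ring R (F * G)%type).
Local Notation iota := (@push R G _ (fun u => (0 : F, u))).
Local Notation twist k := (@push R G _ (fun u => (cls u * k, u))).
Let N : RH := \sum_(k : F) mono (k, 0) 1.

Lemma coef_iota c u y : coef (c, u) (iota y) = if c == 0 then coef u y else 0.
Proof.
elim/gr_ind: y => [|x y IHx IHy|b v].
- by rewrite !raddf0 if_same.
- by rewrite !raddfD /= IHx IHy; case: ifP; rewrite ?addr0.
rewrite -/(mono v b) push_mono !coef_mono xpair_eqE eq_sym.
by case: eqP.
Qed.

Lemma iotaM x y : iota (x * y) = iota x * iota y.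
Proof.
apply: (@pushM _ _ _ _ setT) => // u v _ _.
by rewrite pairD addr0.
Qed.

Lemma iotaX x n : iota (x ^+ n.+1) = iota x ^+ n.+1.
Proof.
elim: n => [|n IH]; first by rewrite !expr1.
by rewrite exprS iotaM IH -exprS.
Qed.

Lemma iota_nilp x : nilp x -> nilp (iota x).
Proof.
by case=> n xn; exists n.+1; rewrite -iotaX exprS xn mulr0 raddf0.
Qed.

Lemma N_translate j : mono (j, 0) 1 * N = N.
Proof.
rewrite /N mulr_sumr [RHS](reindex_inj (addrI j)); apply: eq_bigr => k _.
by rewrite monoM pairD addr0 mulr1.
Qed.

Lemma N2 : N * N = p%:R * N.
Proof.
rewrite {1}/N mulr_suml (eq_bigr (fun=> N)) => [|k _]; last exact: N_translate.
by rewrite sumr_const cardF mulr_natl.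
Qed.

(** Since N * N = p * N, the element p - N is idempotent up to the factor p. *)
Lemma pN_exp m : (p%:R - N) ^+ m.+1 = (p%:R - N) *+ p ^ m.
Proof.
elim: m => [|m IH]; first by rewrite expr1 expn0.
rewrite exprS IH mulrnAr mulrBr [X in _ - X]mulrBl N2 subrr subr0 mulr_natr.
by rewrite expnS mulrnA.
Qed.

Lemma N_mono u a : N * mono (0, u) a = \sum_(k : F) mono (k, u) a.
Proof.
rewrite mulr_suml; apply: eq_bigr => k _.
by rewrite monoM pairD addr0 add0r mul1r.
Qed.

Lemma coef_N_iota c u z : coef (c, u) (N * iota z) = coef u z.
Proof.
rewrite mulr_suml raddf_sum (bigD1 c)//= mulrC coefM_mono mulr1.
rewrite (_ : (c, u) - (c, 0) = (0, u)); last by rewrite opprE pairD subrr subr0.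
rewrite coef_iota eqxx big1 ?addr0// => k kc.
rewrite mulrC coefM_mono (_ : (c, u) - (k, 0) = (c - k, u)); last first.
  by rewrite opprE pairD subr0.
by rewrite coef_iota subr_eq0 eq_sym (negbTE kc) mul0r.
Qed.

Lemma sum_twist x : supp_in L x ->
  \sum_(k : F) twist k x = N * iota x + (p%:R - N) * iota (restrict K x).
Proof.
move: x; apply: supp_ind => [|x y IHx IHy|a u Lu].
- by rewrite !raddf0 !mulr0 addr0 big1// => k _; rewrite raddf0.
- rewrite !raddfD /= !mulrDr addrACA -IHx -IHy -big_split.
  apply: eq_bigr => k _.
  by rewrite raddfD.
rewrite restrict_mono push_mono N_mono; under eq_bigr do rewrite push_mono.
case: asboolP => Ku.
  rewrite push_mono mulrBl N_mono addrC subrK mulr_natl -cardF -sumr_const.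
  by apply: eq_bigr => k _; rewrite (cls_eq0 Lu).2// mul0r.
have cls0 : cls u != 0 by apply/eqP => /(cls_eq0 Lu).1.
by rewrite !raddf0 mulr0 addr0 [RHS](reindex_inj (mulfI cls0)).
Qed.

Lemma regpX (r : R) m : r *+ p ^ m = 0 -> r = 0.
Proof.
by elim: m r => [|m IH] r //; rewrite expnS mulrnA => /IH; apply: regp.
Qed.

(** A power of (p - N) * iota y vanishes, where y is the restriction of x to
    K; its coefficients at (1, u), which come from N alone, are those of a
    power of y up to sign and a power of p. *)
Lemma restrict_eq0 (x : group_ring R G) : reduced_on R K ->
  supp_in L x -> x * x = 0 -> restrict K x = 0.
Proof.
move=> redK Lx xx0.
have : @nilp RH ((p%:R - N) * iota (restrict K x)).
  have -> : (p%:R - N) * iota (restrict K x)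
           = \sum_(k : F) twist k x + (- N) * iota x.
    by rewrite sum_twist// mulNr addrAC subrr add0r.
  apply: nilpD; last by apply/nilpMl/iota_nilp; exists 2%N.
  apply: nilp_sum => k; exists 2%N; rewrite expr2 -(@pushM _ _ _ _ L)//.
    by rewrite xx0 raddf0.
  by move=> u v Lu Lv; rewrite pairD clsD// mulrDl.
case=> m; set y := restrict K x => ym0.
apply: (reduced_on_nilp subK redK); first exact: supp_in_restrict.
exists m.+1; apply/coef_inj => u; rewrite raddf0; apply: (@regpX _ m).
have /(congr1 (coef (1, u))) : ((p%:R - N) * iota y) ^+ m.+1 = 0.
  by rewrite exprS ym0 mulr0.
rewrite exprMn pN_exp -iotaX mulrnAl raddfMn /= mulrBl raddfB /= coef_N_iota.
rewrite mulr_natl raddfMn /= coef_iota oner_eq0 mul0rn sub0r raddf0 mulNrn.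
by move/eqP; rewrite oppr_eq0 => /eqP.
Qed.

(** Translating x by - u moves its coefficient at u to 0, which is in K. *)
Lemma reduced_on_prime_step : reduced_on R K -> reduced_on R L.
Proof.
move=> redK x Lx xx0; apply/coef_inj => u; rewrite raddf0.
have [//|/Lx Lu] := eqVneq (coef u x) 0.
have subL : subgroup L by apply: adjoin_subgroup Kpg => //; exact: prime_gt0.
have : restrict K (x * mono (- u) 1) = 0.
  apply: restrict_eq0 => //; last by rewrite mulrACA xx0 mul0r.
  apply: (supp_inM _ Lx (supp_in_mono (subgroupN subL Lu))) => v w.
  exact: subgroupD.
move=> /(congr1 (coef 0)).
rewrite coef_restrict raddf0 asboolT; last exact: subK.1.
by rewrite coefM_mono sub0r opprK mulr1.
Qed.

End PrimeStep.

Section TorsionStep.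
Variables (R : comNzRingType) (G : zmodType).

(** The multiple m g is reached one prime factor of m at a time; these factors
    are regular because m is. *)
Lemma reduced_on_step m (K : set G) g :
  (0 < m)%N -> natreg R m -> subgroup K -> K (g *+ m) -> reduced_on R K ->
  exists K', [/\ subgroup K', K `<=` K', K' g & reduced_on R K'].
Proof.
elim/ltn_ind: m g => m IH g m0 regm subK Kgm redK.
have [m1|m_gt1] := leqP m 1.
  by exists K; split=> //; move: m0 m1 Kgm; case: m {IH regm} => [|[|]].
set p := pdiv m; have pr_p : prime p by exact: pdiv_prime.
have pm : (p * (m %/ p) = m)%N by rewrite mulnC divnK// pdiv_dvd.
have regp : natreg R p.
  by move=> r rp; apply: regm; rewrite -pm mulrnA rp mul0rn.
have [||||//|K1 [subK1 sK1 K1gp redK1]] := IH (m %/ p)%N _ (g *+ p) _ _ subK.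
- by rewrite ltn_Pdiv ?prime_gt1.
- by rewrite divn_gt0 ?prime_gt0// dvdn_leq// pdiv_dvd.
- by move=> r rq; apply: regm; rewrite -pm mulnC mulrnA rq mul0rn.
- by rewrite -mulrnA pm.
have [K1g|nK1g] := pselect (K1 g); first by exists K1.
exists (adjoin K1 g); split.
- exact: adjoin_subgroup (prime_gt0 pr_p) K1gp.
- by move=> u /sK1; exact: adjoin_sub.
- exact: adjoin_gen.
- exact: reduced_on_prime_step pr_p (pchar_Fp pr_p) (card_Fp pr_p) subK1 K1gp
    nK1g regp redK1.
Qed.

Hypothesis redR : reduced R.
Hypothesis torsion_reg :
  forall u : G, torsion_part u ->
    exists n, [/\ (0 < n)%N, u *+ n = 0 & natreg R n].

Lemma reduced_on0 : reduced_on R [set (0 : G)].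
Proof.
move=> x x0 xx; have xE : x = mono 0 (coef 0 x).
  apply/coef_inj => u; rewrite coef_mono; case: (0 =P u) => [<-//|/eqP u0].
  by apply/eqP; apply: contraNT u0 => /x0 ->.
move: xx; rewrite xE monoM addr0 => /(congr1 (coef 0)).
rewrite coef_mono eqxx raddf0 => /(redR (n := 2)) ->; exact: raddf0.
Qed.

Lemma reduced_on_seq (s : seq G) : (forall u, u \in s -> torsion_part u) ->
  exists K, [/\ subgroup K, (forall u, u \in s -> K u) & reduced_on R K].
Proof.
elim: s => [|u s IH] us.
  exists [set 0]; split=> //; last exact: reduced_on0.
  by split=> // _ _ -> ->; rewrite subrr.
have [|K [subK sK redK]] := IH.
  by move=> v vs; apply: us; rewrite inE vs orbT.
have [n [n0 un regn]] := torsion_reg (us u (mem_head _ _)).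
have [|K' [subK' sKK' K'u redK']] :=
  reduced_on_step n0 regn subK _ redK (g := u).
  by rewrite un; exact: subK.1.
exists K'; split=> // v; rewrite inE => /orP[/eqP ->//|/sK]; exact: sKK'.
Qed.

Lemma reduced_on_torsion : reduced_on R (@torsion_part G).
Proof.
move=> x Tx xx; have [|K [_ sK redK]] := @reduced_on_seq (msupp x).
  by move=> u; rewrite coef_msupp => /Tx.
by apply: redK xx => u; rewrite -coef_msupp; exact: sK.
Qed.

End TorsionStep.

(** * Ordering the group modulo torsion *)

Section TorsionOrder.
Variable G : zmodType.
Local Notation T := (@torsion_part G).

Lemma torsion_subgroup : subgroup T.
Proof.
split; first by exists 1%N.
move=> u v [n n0 un] [m m0 vm]; exists (n * m)%N; first by rewrite muln_gt0 n0.
by rewrite mulrnBl mulrnA un mul0rn mulnC mulrnA vm mul0rn subrr.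
Qed.

(** The nonnegative elements of a preorder of G compatible with addition, in
    which only torsion elements may be equivalent to 0. *)
Definition cone (P : set G) :=
  (forall u v, P u -> P v -> P (u + v)) /\ (forall u, P u -> P (- u) -> T u).

(** A maximal cone A containing the torsion is total. If c is not in A, the
    sums u + c *+ k with u in A cannot form a cone, which puts - (c *+ k) in A
    for some k > 0. If neither a nor - a were in A, a multiple of a and its
    opposite would be in A, so that a would be torsion. *)
Lemma total_cone :
  exists P, [/\ cone P, T `<=` P & forall u, P u \/ P (- u)].
Proof.
have subT := torsion_subgroup.
have [|F sF totF _|A [[AD AN] sTA Amax]] := @Zorn_above G cone T.
- by split=> // u v; exact: subgroupD.
- have mono2 (X Y : set G) : F X -> F Y ->
      exists2 Z, F Z & X `<=` Z /\ Y `<=` Z.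
    move=> FX FY; have [] := totF _ _ FX FY => ?; [exists Y|exists X] => //;
      by split.
  split=> [u v|u] [X FX Xu] [Y FY Yv]; have [Z FZ [XZ YZ]] := mono2 _ _ FX FY.
    by exists Z => //; apply: (sF _ FZ).1; [exact: XZ|exact: YZ].
  by apply: (sF _ FZ).2; [exact: XZ|exact: YZ].
have A0 : A 0 by apply/sTA/subT.1.
have AMn u n : A u -> A (u *+ n).
  by move=> Au; elim: n => [//|n IH]; rewrite mulrSr; apply: AD.
have Anotin c : ~ A c -> exists2 k, (0 < k)%N & A (- (c *+ k)).
  move=> nAc; apply: contrapT => nk; apply: nAc.
  pose B := [set w | exists2 u, A u & exists k, w = u + c *+ k].
  apply: (Amax B); last by exists 0 => //; exists 1%N; rewrite add0r.
    by move=> u Au; exists u => //; exists 0%N; rewrite addr0.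
  split=> [_ _ [u Au [k ->]] [v Av [l ->]]|w [u Au [k ->]] [v Av [l E]]].
    by exists (u + v); [exact: AD | exists (k + l)%N; rewrite mulrnDr addrACA].
  have [kl0|kl_gt0] := posnP (k + l)%N; last first.
    case: nk; exists (k + l)%N => //.
    rewrite (_ : - _ = u + v); first exact: AD.
    apply/eqP; rewrite eq_sym -addr_eq0 mulrnDr addrACA -E; exact/eqP/subrr.
  move: E; have [-> ->] : k = 0%N /\ l = 0%N.
    by move/eqP: kl0; rewrite addn_eq0 => /andP[/eqP -> /eqP ->].
  by rewrite !mulr0n !addr0 => E; apply: AN => //; rewrite E.
exists A; split=> // a; apply: contrapT => /not_orP[nAa nANa].
have [k k0 Ak] := Anotin _ nAa; have [l l0 Al] := Anotin _ nANa.
apply/nAa/sTA; have [n n0 kln] : T (a *+ (k * l)).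
  apply: AN.
    by rewrite mulnC mulrnA; apply: AMn; rewrite -[a]opprK mulNrn.
  by rewrite mulrnA -mulNrn; apply: AMn.
by exists (k * l * n)%N; rewrite ?muln_gt0 ?k0 ?l0// mulrnA.
Qed.

End TorsionOrder.

(** * Homogeneous components modulo torsion *)

Section Graded.
Variables (R : comNzRingType) (G : zmodType).
Local Notation RG := (group_ring R G).
Local Notation T := (@torsion_part G).
Implicit Types (x y z w : RG) (s t u v : G).

Definition coset t : set G := [set u | T (u - t)].

Definition component t : RG -> RG := restrict (coset t).
HB.instance Definition _ t :=
  GRing.isZmodMorphism.Build RG RG (component t)
    (restrict_is_additive (coset t)).

Lemma coset_refl t : coset t t.
Proof. by rewrite /coset /= subrr; exact: (torsion_subgroup G).1. Qed.

Lemma coef_component t x : coef t (component t x) = coef t x.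
Proof. by rewrite coef_restrict asboolT//; exact: coset_refl. Qed.

(** The ring is graded by G modulo its torsion. *)
Lemma componentM_homog s t y z :
  supp_in (coset s) y -> component t (y * z) = y * component (t - s) z.
Proof.
move=> sy; elim/(@supp_ind R G (coset s)): y / sy => [|y y' IH IH'|a u su].
- by rewrite !mul0r raddf0.
- by rewrite !mulrDl -IH -IH' raddfD.
elim/gr_ind: z => [|z z' IH IH'|b v]; first by rewrite mulr0 !raddf0 mulr0.
  by rewrite mulrDr !raddfD /= IH IH' mulrDr.
rewrite -/(mono v b) monoM /component !restrict_mono.
have E : u + v - t = (u - s) + (v - (t - s)).
  by rewrite opprB [v + _]addrCA (addrA (u - s)) subrK addrA.
suff -> : `[< coset t (u + v) >] = `[< coset (t - s) v >].
  by case: ifP; rewrite ?monoM ?mulr0.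
have sT := torsion_subgroup G.
apply: asbool_equiv_eq; rewrite /coset /= E; split=> h; last exact: subgroupD.
by rewrite -[X in T X](addKr (u - s)) addrC; apply: subgroupB.
Qed.

Hypothesis redT : reduced_on R T.

Lemma reduced_on_coset s y : supp_in (coset s) y -> y * y = 0 -> y = 0.
Proof.
move=> sy yy; rewrite -(mono_mul y (- s)) (_ : y * _ = 0) ?mul0r//.
apply: redT; last by rewrite mulrACA yy mul0r.
by apply: supp_inM sy (supp_in_mono (A := [set - s]) erefl) => u _ su ->.
Qed.

Variable P : set G.
Hypotheses (coneP : cone P) (sTP : T `<=` P) (totP : forall u, P u \/ P (- u)).

Let below t : set G := [set u | P (t - u)].

(** A product u * v of degrees below s and t only reaches degree s + t when
    both degrees are extremal. *)
Lemma componentM_top s t x z : supp_in (below s) x -> supp_in (below t) z ->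
  component (s + t) (x * z) = component s x * component t z.
Proof.
move=> sx tz; elim/(@supp_ind R G (below s)): x / sx => [|x x' IH IH'|a u su].
- by rewrite mul0r !raddf0 mul0r.
- by rewrite mulrDl !raddfD /= IH IH' mulrDl.
elim/(@supp_ind R G (below t)): z / tz => [|z z' IH IH'|b v tv].
- by rewrite mulr0 !raddf0 mulr0.
- by rewrite mulrDr !raddfD /= IH IH' mulrDr.
rewrite monoM /component !restrict_mono.
have sT := torsion_subgroup G; have [PD PN] := coneP.
have aux p q : P p -> P q -> T (- (p + q)) -> T (- p).
  move=> Pp Pq Tpq; apply: subgroupN => //; apply: PN => //.
  rewrite (_ : - p = q + - (p + q)); first by apply: PD => //; exact: sTP.
  by rewrite opprD addrCA subrr addr0.
have E : u + v - (s + t) = - ((s - u) + (t - v)).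
  by rewrite opprD [RHS]opprD !opprB addrACA.
suff -> : `[< coset (s + t) (u + v) >] = `[< coset s u >] && `[< coset t v >].
  by do 2!case: asboolP => _ /=; rewrite ?monoM ?mulr0 ?mul0r.
rewrite -asbool_and; apply: asbool_equiv_eq; rewrite /coset /=.
split=> [|[h h']].
  rewrite E => h; split; rewrite -opprB; first exact: aux h.
  by apply: aux su _ => //; rewrite addrC.
by rewrite opprD addrACA; apply: subgroupD.
Qed.

Lemma exists_top x : x != 0 -> exists2 s, coef s x != 0 & supp_in (below s) x.
Proof.
move=> x0; have [PD _] := coneP.
have max (r : seq G) : r != [::] ->
    exists2 m, m \in r & forall u, u \in r -> P (m - u).
  have P0 : P 0 by apply: sTP; exact: (torsion_subgroup G).1.
  elim: r => // u [_ _|v r].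
    by exists u; rewrite ?inE// => v; rewrite inE => /eqP ->; rewrite subrr.
  move=> /(_ isT)[m mr mmax] _; have [Pmu|Pum] := totP (m - u).
    exists m; first by rewrite inE mr orbT.
    by move=> w; rewrite inE => /orP[/eqP ->//|/mmax].
  exists u; first by rewrite mem_head.
  move=> w; rewrite inE => /orP[/eqP ->|/mmax Pmw]; first by rewrite subrr.
  by rewrite -(subrKA m); apply: PD => //; rewrite -opprB.
have [|s sx smax] := max (msupp x).
  apply: contra x0 => /eqP nx; apply/eqP/coef_inj => u; rewrite raddf0.
  apply/eqP; rewrite -[_ == _]negbK -coef_msupp.
  by rewrite -[u \in _]/(u \in enum_fset (msupp x)) nx.
by exists s => [|u]; rewrite -coef_msupp//; exact: smax.
Qed.

(** The top component of x * x is the square of the top component of x, which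
    is a torsion-supported element up to translation. *)
Lemma group_ring_reduced x : x * x = 0 -> x = 0.
Proof.
move=> xx; apply: contrapT => /eqP/exists_top[s /eqP sx s_top]; apply: sx.
rewrite -coef_component (_ : component s x = 0) ?raddf0//.
apply: (reduced_on_coset (s := s)); first exact: supp_in_restrict.
by rewrite -componentM_top// xx raddf0.
Qed.

(** Let c be the top component of w, and suppose that c * z has a nonzero top
    component d. As w * (c * z) = 0, also c * d = 0; but d is a multiple of c,
    so d * d = 0. *)
Lemma component_top_ann s w z :
  supp_in (below s) w -> w * z = 0 -> component s w * z = 0.
Proof.
move=> s_top wz; set y := component s w * z.
apply: contrapT => /eqP/exists_top[t /eqP ty t_top]; apply: ty.
rewrite -coef_component (_ : component t y = 0) ?raddf0//.
apply: group_ring_reduced.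
have E : component t y = component s w * component (t - s) z.
  by apply: componentM_homog; exact: supp_in_restrict.
rewrite {1}E mulrAC -componentM_top// /y mulrCA wz mulr0 raddf0 mul0r//.
Qed.

(** The graded form of McCoy's theorem: an element of a reduced graded ring is
    killed only by what kills each of its components. The top component is
    removed repeatedly. *)
Lemma component_ann w z t : w * z = 0 -> component t w * z = 0.
Proof.
have [n] := ubnP #|` msupp w|; elim: n w => // n IH w lt_n wz.
have [->|/exists_top[s sw s_top]] := eqVneq w 0; first by rewrite raddf0 mul0r.
set c := component s w; have cz : c * z = 0 by exact: component_top_ann.
rewrite -(subrK c w) raddfD /= mulrDl IH ?add0r; last first.
- by rewrite mulrBl wz cz subrr.
- apply: (leq_trans _ (lt_n : #|` msupp w| <= n)%N).
  apply: fproper_ltn_card; rewrite fproperE; apply/andP; split.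
    apply/fsubsetP => u; rewrite !coef_msupp raddfB /= coef_restrict.
    by case: ifP => _; rewrite ?subrr ?eqxx ?subr0.
  apply/fsubsetPn; exists s; first by rewrite coef_msupp.
  by rewrite coef_msupp raddfB /= coef_component subrr eqxx.
rewrite -[c]mulr1 (@componentM_homog s); last exact: supp_in_restrict.
by rewrite mulrAC cz mul0r.
Qed.

End Graded.

(** * Annihilator complements in integral extensions *)

(** The products of one element from each complement complement a list. *)
Lemma ann_complement_seq (A : comNzRingType) (S : set A) :
  S 1 -> (forall a b, S a -> S b -> S (a * b)) ->
  (forall r, S r -> exists2 F, ann_complement [:: r] F & [set` F] `<=` S) ->
  forall rs, [set` rs] `<=` S ->
  exists2 F, ann_complement rs F & [set` F] `<=` S.
Proof.
move=> S1 SM annS; elim=> [|r rs IH] rsS.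
  exists [:: 1]; last by move=> f /=; rewrite inE => /eqP ->.
  by split=> // z /(_ 1 (mem_head _ _)); rewrite mulr1.
have [s srs|F2 [rF2 faith2] F2S] := IH.
  by apply: rsS; rewrite /= inE srs orbT.
have [F1 [rF1 faith1] F1S] := annS r (rsS r (mem_head _ _)).
exists [seq f1 * f2 | f1 <- F1, f2 <- F2]; last first.
  by move=> _ /= /allpairsP[[f1 f2] /= [/F1S ? /F2S ? ->]]; exact: SM.
split=> [c _ cs /allpairsP[[f1 f2] /= [f1F f2F ->]]|z zkill].
  move: cs; rewrite inE => /orP[/eqP ->|crs]; last first.
    by rewrite mulrCA (rF2 c f2)// mulr0.
  by rewrite mulrA (rF1 r f1 (mem_head _ _) f1F) mul0r.
apply: faith1 => f1; rewrite mem_cat inE => /orP[/eqP ->|f1F].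
  by apply: zkill; rewrite mem_cat mem_head.
apply: faith2 => f2; rewrite mem_cat => /orP[f2rs|f2F].
  by rewrite mulrAC zkill ?mul0r// mem_cat inE f2rs orbT.
by rewrite -mulrA; apply: zkill; rewrite mem_cat allpairs_f ?orbT.
Qed.

Section Integral.
Variables (R A : comNzRingType) (phi : {rmorphism R -> A}).
Hypothesis redA : reduced A.
Hypothesis phi_faithful : forall cs, faithful cs -> faithful (map phi cs).
Hypothesis annR : forall cs : seq R, exists F, ann_complement cs F.

Lemma horner_ann (z r : A) (q : {poly A}) : z * r = 0 -> z * q.[r] = z * q`_0.
Proof.
move=> zr; elim/poly_ind: q => [|q c _]; first by rewrite horner0 coef0.
rewrite hornerMXaddC coefD coefMX coefC/= add0r mulrDr.
by rewrite mulrCA zr mulr0 add0r.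
Qed.

(** Let p = sum of the c_i 'X^i be monic with root r. If f kills c_0, ...,
    c_(e-1), then f p is f q_e 'X^e with q_e = drop_poly e p, so f q_e(r)
    r ^+ e = 0 and, the ring being reduced, f q_e(r) kills r. The family F
    collects these elements for e > 0 and f in a complement of the first e
    coefficients. If z kills r and F, then z kills c_0, and inductively each
    c_e: as z r = 0, one has z f q_e(r) = z f c_e, so z c_e is killed by the
    first e coefficients and their complement. As the leading coefficient
    is 1, z = 0. *)
Lemma ann_complement_integral r : integralOver phi r ->
  exists2 F, ann_complement [:: r] F &
    forall f, f \in F -> exists q : {poly R}, f = (map_poly phi q).[r].
Proof.
case=> p p_monic /rootP pr0.
have [Fe FeP] := choice (fun e => annR (take e p)).
pose ev (q : {poly R}) := (map_poly phi q).[r].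
exists [seq ev (f *: drop_poly e p) | e <- iota 1 (size p).-1, f <- Fe e];
  last first.
  by move=> _ /allpairsPdep[e [f [_ _ ->]]]; exists (f *: drop_poly e p).
have evE q1 q2 e : ev (q1 + q2 * 'X^e) = ev q1 + ev q2 * r ^+ e.
  by rewrite /ev rmorphD rmorphM /= map_polyXn hornerD hornerM hornerXn.
have ev0 z q : z * r = 0 -> z * ev q = z * phi q`_0.
  by move=> zr; rewrite horner_ann// coef_map.
split=> [c y /[!inE]/eqP -> /allpairsPdep[e [f [e_iota fFe ->]]]|z zkill].
  have e0 : (0 < e)%N by move: e_iota; rewrite mem_iota => /andP[].
  have f_take : f *: take_poly e p = 0.
    apply/polyP => i; rewrite coefZ coef0 coef_take_poly.
    case: ltnP => [lt_ie|]; last by rewrite mulr0.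
    have [le_pi|lt_ip] := leqP (size p) i; first by rewrite nth_default// mulr0.
    rewrite mulrC; apply: (FeP e).1 => //.
    by rewrite -(nth_take 0 lt_ie) mem_nth// size_take_min ltn_min lt_ie.
  have evp : ev (f *: p) = 0.
    by rewrite /ev -mul_polyC rmorphM hornerM pr0 mulr0.
  have yre : ev (f *: drop_poly e p) * r ^+ e = 0.
    rewrite -evp -[in RHS](poly_take_drop e p) scalerDr scalerAl evE f_take.
    by rewrite /ev rmorph0 horner0 add0r.
  apply: (redA (n := e)).
  by rewrite mulrC exprMn -(prednK e0) exprSr -mulrA (prednK e0) yre mulr0.
have zr : z * r = 0 by apply: zkill; rewrite mem_head.
have zp i : (i <= (size p).-1)%N -> z * phi p`_i = 0.
  elim/ltn_ind: i => -[|i] IH le_ip.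
    by rewrite -ev0// /ev pr0 mulr0.
  apply: (phi_faithful (FeP i.+1).2) => _ /mapP[c + ->].
  rewrite mem_cat => /orP[/(nthP 0)[j]|cF].
    rewrite size_take_min ltn_min => /andP[lt_ji lt_jp] <-.
    rewrite nth_take// mulrAC IH ?mul0r//.
    by rewrite (leq_trans _ le_ip)// ltnW.
  have : z * ev (c *: drop_poly i.+1 p) = 0.
    apply: zkill; rewrite mem_cat; apply/orP; right; apply/allpairsPdep.
    by exists i.+1, c; rewrite mem_iota/= add1n ltnS.
  by rewrite ev0// coefZ coef_drop_poly add0n rmorphM [phi c * _]mulrC mulrA.
have := zp _ (leqnn _).
by rewrite -/(lead_coef p) (monicP p_monic) rmorph1 mulr1.
Qed.

End Integral.

(** * The group ring of a group that is not torsion *)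

Section Main.
Variables (R : comNzRingType) (G : zmodType).
Local Notation RG := (group_ring R G).
Local Notation T := (@torsion_part G).

Lemma complemented_reduced (S : comNzRingType) : complemented S -> reduced S.
Proof.
move=> cS; apply: reduced_of_sqr => x xx; have [y xy] := cS x.
by apply; rewrite mulrDl xx mulrC xy addr0.
Qed.

Lemma gr_const_inj (r : R) : gr_const r = 0 :> RG -> r = 0.
Proof. by move/(congr1 (coef 0)); rewrite coef_mono eqxx raddf0. Qed.

(** The coefficients of a complement of the constant r complement r in R. *)
Lemma complemented_ann_complement : complemented RG ->
  forall r : R, exists F, ann_complement [:: r] F.
Proof.
move=> cRG r; have [y ry regy] := cRG (gr_const r).
exists [seq coef g y | g <- msupp y]; split.
  move=> _ _ /[!inE] /eqP -> /mapP[g _ ->].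
  by rewrite mulrC -coefM_const mulrC ry raddf0.
move=> z zkill; apply/gr_const_inj/regy.
rewrite mulrDl -rmorphM mulrC zkill ?mem_head// rmorph0 add0r.
apply/coef_inj => g; rewrite coefM_const raddf0 mulrC.
have [->|gy] := eqVneq (coef g y) 0; first by rewrite mulr0.
apply: zkill; rewrite mem_cat; apply/orP; right; apply/mapP; exists g => //.
by rewrite coef_msupp.
Qed.

(** If e is the sum of the n powers of g, then e * e = n e; so r n = 0 makes
    r e square-zero. *)
Lemma reduced_reg_order (n : nat) : reduced RG -> torsion_orders G n ->
  natreg R n.
Proof.
move=> redRG [g _ [n0 gn gmin]] r rn.
pose e : RG := \sum_(i < n) mono (g *+ i) 1.
have ge : mono g 1 * e = e.
  rewrite /e mulr_sumr; case: n n0 gn {gmin rn e} => // n _ gn.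
  rewrite big_ord_recr [RHS]big_ord_recl /= monoM -mulrS gn addrC mulr1 mulr0n.
  by congr (_ + _); apply: eq_bigr => i _; rewrite monoM -mulrS mulr1.
have gie i : mono (g *+ i) 1 * e = e.
  elim: i => [|i IH]; first by rewrite mono10 mul1r.
  by rewrite mulrS -[1]mulr1 -monoM -mulrA IH ge.
have ee : e * e = e *+ n.
  by rewrite {1}/e mulr_suml (eq_bigr (fun=> e))// sumr_const card_ord.
have x0 : gr_const r * e = 0.
  apply: (redRG _ 2); rewrite expr2 mulrACA ee mulrnAr -mulrnAl -mulrnAr.
  by rewrite -raddfMn /= rn raddf0 mulr0 mul0r.
move/(congr1 (coef 0)): x0; rewrite mulrC coefM_const raddf0 raddf_sum /=.
rewrite (bigD1 (Ordinal n0))//= coef_mono mulr0n eqxx big1 ?addr0 ?mul1r// => i.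
rewrite coef_mono -val_eqE /= -lt0n => i0; case: eqP => // /(gmin i i0).
by rewrite leqNgt ltn_ord.
Qed.

Lemma torsion_has_order (u : G) : T u ->
  exists n, [/\ (0 < n)%N, u *+ n = 0 & torsion_orders G n].
Proof.
move=> Tu; have [n n0 un] := Tu.
have exn : exists n, (0 < n)%N && (u *+ n == 0) by exists n; rewrite n0 un eqxx.
have [m /andP[m0 /eqP um] mmin] := ex_minnP exn.
exists m; split=> //; exists u => //; split=> // k k0 uk.
by apply: mmin; rewrite k0 uk eqxx.
Qed.

(** A group element of order dividing n is a root of 'X^n - 1. *)
Lemma integral_torsion (x : RG) : supp_in T x -> integralOver gr_const x.
Proof.
move: x; apply: supp_ind => [|x y|a u [n n0 un]]; first exact: integral0.
  exact: integral_add.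
have -> : mono u a = gr_const a * mono u 1 by rewrite monoM add0r mulr1.
apply: integral_mul; first exact: integral_id.
exists ('X^n - 1%:P); first exact: monicXnsubC.
apply/rootP; rewrite rmorphB /= map_polyXn map_polyC hornerD hornerXn hornerN.
rewrite hornerC /= rmorph1.
suff -> : mono u 1 ^+ n = 1 :> RG by rewrite subrr.
rewrite -mono10 -un; elim: n {n0 un} => [|n IH]; first by rewrite mulr0n expr0.
by rewrite exprS IH monoM mulr1 mulrS.
Qed.

Lemma gr_const_faithful (cs : seq R) :
  faithful cs -> faithful [seq gr_const c : RG | c <- cs].
Proof.
move=> faith z zcs; apply/coef_inj => g; rewrite raddf0; apply: faith => c ccs.
by rewrite -coefM_const zcs ?raddf0// map_f.
Qed.

Lemma supp_in_torsion_horner (q : {poly R}) (x : RG) :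
  supp_in T x -> supp_in T (map_poly gr_const q).[x].
Proof.
have sT := torsion_subgroup G; move=> Tx.
elim/poly_ind: q => [|q c IH].
  by rewrite rmorph0 horner0; exact: supp_in0.
rewrite rmorphD rmorphM /= map_polyX map_polyC hornerMXaddC; apply: supp_inD.
  by apply: supp_inM IH Tx => u v; exact: subgroupD.
by apply: supp_in_mono; exact: sT.1.
Qed.

Lemma component_eq (s t : G) (x : RG) :
  T (t - s) -> component s x = component t x.
Proof.
have sT := torsion_subgroup G; move=> Tts.
rewrite /component (_ : coset s = coset t)//; apply/seteqP; split=> u su.
  rewrite /coset /= -(subrKA s); apply: subgroupD => //.
  by rewrite -opprB; exact: subgroupN.
by rewrite /coset /= -(subrKA t); apply: subgroupD.
Qed.

Lemma component_eq0 (s : G) (x : RG) :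
  (forall t, t \in msupp x -> ~ T (t - s)) -> component s x = 0.
Proof.
move=> xs; apply/coef_inj => u; rewrite coef_restrict raddf0.
case: asboolP => // Tus; have [//|] := eqVneq (coef u x) 0.
by rewrite -coef_msupp => /xs/(_ Tus).
Qed.

Lemma component_ann_all (x z : RG) :
  (forall t, t \in msupp x -> component t x * z = 0) ->
  forall s, component s x * z = 0.
Proof.
move=> xz s.
have [[t tx Tts]|nt] := pselect (exists2 t, t \in msupp x & T (t - s)).
  by rewrite (component_eq _ Tts) xz.
by rewrite component_eq0 ?mul0r// => t tx Tts; apply: nt; exists t.
Qed.

Lemma supp_in_coset0 (f : RG) : supp_in T f -> supp_in (coset 0) f.
Proof. by apply: supp_inS => u; rewrite /coset /= subr0. Qed.

Lemma homog_ann (x f : RG) : supp_in T f ->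
  (forall t, t \in msupp x -> component t x * f = 0) -> x * f = 0.
Proof.
move=> Tf xf; apply/coef_inj => s; rewrite raddf0 -coef_component mulrC.
rewrite (componentM_homog _ _ (supp_in_coset0 Tf)) subr0 mulrC.
by rewrite component_ann_all ?raddf0.
Qed.

Section NonTorsion.
Variable g : G.
Hypothesis nTg : ~ T g.

Lemma nontorsion_inj i j : T (g *+ i - g *+ j) -> i = j.
Proof.
have sT := torsion_subgroup G.
wlog le_ij : i j / (j <= i)%N => [th|].
  have [/th//|/ltnW/th th'] := leqP j i.
  by rewrite -opprB => /(subgroupN sT); rewrite opprK => /th' ->.
rewrite -mulrnBr// => -[n n0 gn]; apply: contrapT => /eqP nij; apply: nTg.
exists ((i - j) * n)%N; last by rewrite mulrnA.
by rewrite muln_gt0 n0 andbT subn_gt0 ltn_neqAle eq_sym nij.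
Qed.

Lemma nontorsion_escape (r : seq G) :
  exists N, forall u j, u \in r -> (N <= j)%N -> ~ T (g *+ j - u).
Proof.
have sT := torsion_subgroup G.
elim: r => [|u r [N rN]]; first by exists 0%N.
have [[k Tk]|nk] := pselect (exists k, T (g *+ k - u)); last first.
  exists N => v j; rewrite inE => /orP[/eqP -> _ Tj|/rN]; last exact.
  by apply: nk; exists j.
exists (maxn N k.+1) => v j.
rewrite inE geq_max => /orP[/eqP ->|/rN vr] /andP[Nj kj].
  move=> Tj; have := @nontorsion_inj j k; rewrite -(subrKA u) -(opprB _ u).
  by move=> /(_ (subgroupB sT Tj Tk)) E; rewrite E ltnn in kj.
exact: vr.
Qed.

Hypothesis redT : reduced_on R T.
Hypothesis annT : forall r : RG, supp_in T r ->
  exists2 F, ann_complement [:: r] F & [set` F] `<=` supp_in T.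

(** The components of x, translated into torsion degree, have a complement F.
    Its elements are placed in pairwise distinct degrees h i that x does not
    meet, which is possible because g has infinite order modulo torsion. Then
    the components of x + y are exactly those of x and the translates of the
    elements of F, so by component_ann nothing but 0 kills x + y. *)
Lemma nontorsion_complemented_elt (x : RG) : complemented_elt x.
Proof.
have sT := torsion_subgroup G; have [P [coneP sTP totP]] := total_cone G.
pose rs : seq RG := [seq component t x * mono (- t) 1 | t <- msupp x].
have rsT : [set` rs] `<=` supp_in T.
  move=> _ /= /mapP[t tx ->].
  apply: supp_inM (@supp_in_restrict _ _ _ _) _; last first.
    exact: (supp_in_mono (A := [set - t]) erefl).
  by move=> u _ tu ->.
have [||F [rsF faithF] FT] := ann_complement_seq _ _ annT rsT.
- by rewrite -mono10; apply: supp_in_mono; exact: sT.1.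
- by move=> a b; apply: supp_inM => u v; exact: subgroupD.
have {}FT (i : 'I_(size F)) : supp_in T F`_i by apply: FT; rewrite /= mem_nth.
have [N xN] := nontorsion_escape (msupp x).
pose h i := g *+ (N + i).
have hx i t : t \in msupp x -> ~ T (h i - t).
  by move=> tx; apply: xN => //; exact: leq_addr.
have hh i j : T (h i - h j) -> i = j by move=> /nontorsion_inj/addnI.
pose y : RG := \sum_(i < size F) F`_i * mono (h i) 1.
have compy t : component t y =
    \sum_(i < size F) F`_i * component t (mono (h i) 1).
  rewrite raddf_sum; apply: eq_bigr => i _ /=.
  by rewrite (componentM_homog _ _ (supp_in_coset0 (FT i))) subr0.
have xF (i : 'I_(size F)) : x * F`_i = 0.
  apply: homog_ann (FT i) _ => t tx; rewrite -[component t x](mono_mul _ (- t)).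
  by rewrite mulrAC (rsF _ F`_i) ?mul0r ?mem_nth//; apply/mapP; exists t.
exists y; first by rewrite mulr_sumr big1// => i _; rewrite mulrA xF mul0r.
move=> z xyz; apply: faithF => c; rewrite mem_cat => /orP[/mapP[t tx ->]|].
  have := component_ann redT coneP sTP totP t xyz.
  rewrite raddfD /= compy big1 ?addr0 => [tz|i _].
    by rewrite mulrCA mulrA tz mul0r.
  rewrite /component restrict_mono; case: asboolP; last by rewrite mulr0.
  by move=> /hx; case.
move=> /(nthP 0)[i ltiF <-].
have := component_ann redT coneP sTP totP (h i) xyz.
rewrite raddfD /= compy component_eq0 ?add0r => [|t tx]; last first.
  by rewrite -opprB => /(subgroupN sT); rewrite opprK; exact: hx.
rewrite (bigD1 (Ordinal ltiF))//= big1 ?addr0 => [|j ij]; last first.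
  rewrite /component restrict_mono; case: asboolP => [/hh ji|_];
    last exact: mulr0.
  by rewrite -val_eqE /= ji eqxx in ij.
rewrite /component restrict_mono asboolT; last exact: coset_refl.
move=> Fz; rewrite -(mono_mul (z * F`_i) (h i)) (_ : _ * mono (h i) 1 = 0).
  by rewrite mul0r.
by rewrite -mulrA mulrC.
Qed.

End NonTorsion.

End Main.

Unset Implicit Arguments.

Theorem theorem2p3 (R : comNzRingType) (G : zmodType)
    (nontorsion : ~ torsion_group G) :
  complemented (group_ring R G) <->
  [/\ reduced R,
      cover_compact [set: MinSpec R]
    & [set n%:R | n in torsion_orders G] `<=` @reg R].
Proof.
split=> [cRG|[redR cptR ordR]].
  have redRG := complemented_reduced cRG.
  have redR : reduced R.
    move=> r n rn; apply: (@gr_const_inj R G); apply: (redRG _ n).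
    by rewrite -rmorphXn rn raddf0.
  split=> //.
    exact/ann_complement_compact/complemented_ann_complement/cRG.
  move=> _ [n ordn <-] r; rewrite mulr_natl; exact: reduced_reg_order ordn r.
have /existsNP[g nTg] := nontorsion.
have redT : reduced_on R (@torsion_part G).
  apply: reduced_on_torsion => // u /torsion_has_order[n [n0 un ordn]].
  exists n; split=> // r rn; apply: (ordR n%:R); first by exists n.
  by rewrite mulr_natl.
have annR cs := @compact_ann_complement R redR cs cptR.
have [P [coneP sTP totP]] := total_cone G.
have redRG : reduced (group_ring R G).
  apply: reduced_of_sqr => x; exact: (group_ring_reduced redT coneP sTP totP).
move=> x; apply: (nontorsion_complemented_elt nTg redT) => r Tr.
have [F rF Fr] := ann_complement_integral redRG (@gr_const_faithful R G) annR
  (integral_torsion Tr).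
by exists F => // _ /Fr[q ->]; exact: supp_in_torsion_horner.
Qed.
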